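(* For every integer $k\ge 2$ there exists $n_0\in\mathbb{N}$ such that for all integers $n\ge n_0$ (with $n\ge 2k$, so that $K_{n,k}$ is defined), $$diss(K_{n,k})=\alpha(K_{n,k})=\binom{n-1}{k-1}.$$
   Context: For positive integers $n,k$ with $n\ge 2k$, the Kneser graph $K_{n,k}$ has as vertices all $k$-element subsets of $[n]=\{1,\dots,n\}$, two of them being adjacent if and only if they are disjoint. A set $D$ of vertices of a graph $G$ is a dissociation set if the subgraph of $G$ induced by $D$ has maximum degree at most $1$. The dissociation number $diss(G)$ is the maximum cardinality of a dissociation set in $G$, and $\alpha(G)$ is the independence number of $G$, i.e. the maximum cardinality of a set of pairwise non-adjacent vertices. *)

(* Defs.v *)
From mathcomp Require Import all_boot.

Set Implicit Arguments.
Unset Strict Implicit.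
Unset Printing Implicit Defensive.

(* A finite graph is given by its adjacency relation [e : rel T], which is
   symmetric and irreflexive in the intended use. *)

Definition induced_degree (T : finType) (e : rel T) (D : {set T}) (x : T) : nat :=
  #|[set y in D | e x y]|.

Definition induced_max_degree (T : finType) (e : rel T) (D : {set T}) : nat :=
  \max_(x in D) induced_degree e D x.

Definition dissociation_set (T : finType) (e : rel T) (D : {set T}) : bool :=
  induced_max_degree e D <= 1.

Definition independent_set (T : finType) (e : rel T) (S : {set T}) : bool :=
  [forall x in S, forall y in S, ~~ e x y].

(* [set0] satisfies both predicates, so the two maxima below range over
   nonempty families. *)

Definition diss (T : finType) (e : rel T) : nat :=
  \max_(D : {set T} | dissociation_set e D) #|D|.

Definition alpha (T : finType) (e : rel T) : nat :=
  \max_(S : {set T} | independent_set e S) #|S|.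

(* The ground set [n] is represented by ['I_n]. *)
Definition kneser_vertex (n k : nat) := {A : {set 'I_n} | #|A| == k}.

Definition kneser (n k : nat) : rel (kneser_vertex n k) :=
  fun A B => [disjoint val A & val B].
Arguments kneser : clear implicits.

Lemma kneser_sym (n k : nat) : symmetric (kneser n k).
Proof. by move=> A B; rewrite /kneser disjoint_sym. Qed.

Lemma kneser_irr (n k : nat) : 0 < k -> irreflexive (kneser n k).
Proof.
move=> k_gt0 A; apply/negbTE; rewrite /kneser -setI_eq0 setIid -card_gt0.
by rewrite (eqP (valP A)).
Qed.

(* Main.v *)
Require Import Defs.
From mathcomp Require Import all_boot.

(** An intersecting family of [k]-sets, and more generally a dissociation set of
    the Kneser graph, is either contained in a star (all [k]-sets through one
    point, of which there are ['C(n - 1, k - 1)]), or each of its members, with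
    at most two exceptions, contains one of [k ^ 2] fixed pairs of points.

    Indeed, let [D] be a dissociation set.  If [D] contains two disjoint sets
    [A] and [B], they use up each other's single allowed neighbour, so every
    other member of [D] meets both [A] and [B], hence contains one of the
    [k ^ 2] pairs [{x, y}] with [x] in [A] and [y] in [B].  If [D] is
    intersecting but has no common point, fix [A] in [D] and for each [x] choose
    [G x] in [D] avoiding [x]; every member of [D] contains some [x] in [A] and
    some [y] in [G x], with [y] different from [x], so again [k ^ 2] pairs
    suffice.  Lemma [card_two_step_cover] treats both situations at once: it
    bounds such a family by [k ^ 2 * 'C(n - 2, k - 2)].

    As ['C(n - 1, k - 1)] is larger than ['C(n - 2, k - 2)] by the factor
    [(n - 1) / (k - 1)], the star wins once [n] exceeds a polynomial in [k]
    (lemma [pair_bound_le_star]).  The star is independent, and independent sets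
    are dissociation sets, so it attains both maxima. *)

Set Implicit Arguments.
Unset Strict Implicit.
Unset Printing Implicit Defensive.

(** * Counting *)

Lemma card_supersets (T : finType) (S : {set T}) (k : nat) :
  #|S| <= k ->
  #|[set A : {set T} | (S \subset A) && (#|A| == k)]|
    = 'C(#|T| - #|S|, k - #|S|).
Proof.
move=> leSk; have -> : #|T| - #|S| = #|~: S| by rewrite [RHS]cardsCs setCK.
rewrite -cards_draws -[RHS](card_in_imset (f := setU S)); last first.
  move=> B1 B2; rewrite !inE => /andP[sB1 _] /andP[sB2 _] eqB.
  have dropS (B : {set T}) : B \subset ~: S -> (S :|: B) :\: S = B.
    rewrite -disjoints_subset => /setDidPl dB.
    by rewrite setDUl setDv set0U.
  by rewrite -(dropS _ sB1) -(dropS _ sB2) eqB.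
apply: eq_card => A; rewrite inE; apply/idP/imsetP => [/andP[sSA /eqP cA] | [B]].
  exists (A :\: S); last by rewrite setDE setUIr setUCr setIT; apply/esym/setUidPr.
  by rewrite inE setDE subsetIr -setDE cardsD (setIidPr sSA) cA eqxx.
rewrite inE -disjoints_subset disjoint_sym => /andP[dSB /eqP cB] ->.
by rewrite subsetUl cardsU (disjoint_setI0 dSB) cards0 subn0 cB subnKC ?eqxx.
Qed.

Definition vertices_above (n k : nat) (S : {set 'I_n}) :
  {set kneser_vertex n k} :=
  [set A : kneser_vertex n k | S \subset val A].
Arguments vertices_above : clear implicits.

Lemma card_vertices_above (n k : nat) (S : {set 'I_n}) :
  #|S| <= k -> #|vertices_above n k S| = 'C(n - #|S|, k - #|S|).
Proof.
move=> leSk; rewrite -[n in 'C(n - _, _)]card_ord -(card_supersets leSk).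
rewrite -(card_imset (vertices_above n k S) val_inj).
apply: eq_card => A; rewrite inE; apply/imsetP/andP => [[B] | [sSA cA]].
  by rewrite inE => sSB ->; split=> //; exact: (valP B).
by exists (Sub A cA : kneser_vertex n k); rewrite ?inE SubK.
Qed.

Lemma card_star (n k : nat) (x : 'I_n) :
  0 < k -> #|vertices_above n k [set x]| = 'C(n - 1, k - 1).
Proof. by move=> k_gt0; rewrite card_vertices_above cards1. Qed.

Lemma card_bigcup_le (I T : finType) (F : {set I}) (U : I -> {set T}) (k m : nat) :
  #|F| <= k -> (forall i, i \in F -> #|U i| <= m) ->
  #|\bigcup_(i in F) U i| <= k * m.
Proof.
move=> leFk leUm; apply: (@leq_trans (\sum_(i in F) m)); last first.
  by rewrite sum_nat_const leq_mul2r leFk orbT.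
apply: (@leq_trans (\sum_(i in F) #|U i|)); last exact: leq_sum.
elim/big_rec2: _ => [|i n B _ IH]; first by rewrite cards0.
by apply: leq_trans (leq_card_setU _ _) _; rewrite leq_add2l.
Qed.

(** The second set [G x] may depend on the point [x] of [F] already hit; it
    avoids [x], so that each member of [E] is forced to contain one of [k ^ 2]
    genuine pairs. *)
Lemma card_two_step_cover (n k : nat) (E : {set kneser_vertex n k})
    (F : kneser_vertex n k) (G : 'I_n -> kneser_vertex n k) :
  2 <= k ->
  (forall x, x \in val F -> x \notin val (G x)) ->
  (forall H, H \in E -> ~~ kneser n k F H) ->
  (forall H x, H \in E -> x \in val F -> ~~ kneser n k (G x) H) ->
  #|E| <= k ^ 2 * 'C(n - 2, k - 2).
Proof.
move=> k_ge2 avoidG meetF meetG.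
have sub : E \subset \bigcup_(x in val F) \bigcup_(y in val (G x))
                       vertices_above n k [set x; y].
  apply/subsetP => H HE.
  have /pred0Pn[x /andP[/= xF xH]] := meetF H HE.
  have /pred0Pn[y /andP[/= yG yH]] := meetG H x HE xF.
  apply/bigcupP; exists x => //; apply/bigcupP; exists y => //.
  by rewrite inE subUset !sub1set; apply/andP.
apply: leq_trans (subset_leq_card sub) _.
rewrite -mulnn -mulnA; apply: card_bigcup_le => [|x xF].
  by rewrite (eqP (valP F)).
apply: card_bigcup_le => [|y yG]; first by rewrite (eqP (valP (G x))).
have neq_xy : x != y by apply: contraNneq (avoidG x xF) => {1}->.
have card2 : #|[set x; y]| = 2 by rewrite cards2 neq_xy.
by rewrite card_vertices_above card2.
Qed.

Lemma pair_bound_le_star (n k : nat) :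
  2 <= k <= n -> (k - 1) * (k ^ 2 + 2) < n ->
  k ^ 2 * 'C(n - 2, k - 2) + 2 <= 'C(n - 1, k - 1).
Proof.
case: k => [|[|k]] //; case: n => [|[|n]] // /andP[_ le_kn].
rewrite !subSS !subn0 => n_large.
have binP : 0 < 'C(n, k) by rewrite bin_gt0.
apply: (@leq_trans ((k.+2 ^ 2 + 2) * 'C(n, k))).
  by rewrite mulnDl leq_add2l leq_pmulr.
(* The factor (n - 1) / (k - 1) comes from the absorption identity for binomials. *)
rewrite -(leq_pmul2l (ltn0Sn k)) -mul_bin_diag mulnA leq_mul2r.
by rewrite -ltnS n_large orbT.
Qed.

(** * The two parameters of a Kneser graph *)

Lemma dissociationP (T : finType) (e : rel T) (D : {set T}) :
  reflect (forall x y z, x \in D -> y \in D -> z \in D ->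
             e x y -> e x z -> y = z)
          (dissociation_set e D).
Proof.
apply: (iffP (bigmax_leqP _ _ _)) => [deg x y z xD yD zD exy exz | uniq_nbr x xD].
  by have /card_le1_eqP := deg x xD; apply; rewrite inE ?yD ?zD.
apply/card_le1_eqP => y z; rewrite !inE => /andP[yD exy] /andP[zD exz].
exact: (uniq_nbr x).
Qed.

Lemma alpha_le_diss (T : finType) (e : rel T) : alpha e <= diss e.
Proof.
apply/bigmax_leqP => S /forall_inP indS.
apply: (@leq_bigmax_cond _ (dissociation_set e) (fun D => #|D|)).
apply/dissociationP => x y z xS yS _ exy.
by have /forall_inP/(_ y yS) := indS x xS; rewrite exy.
Qed.

Lemma star_le_alpha (n k : nat) (x : 'I_n) :
  0 < k -> 'C(n - 1, k - 1) <= alpha (kneser n k).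
Proof.
move=> k_gt0; rewrite -(card_star x k_gt0).
apply: (@leq_bigmax_cond _ (independent_set (kneser n k)) (fun S => #|S|)).
apply/forall_inP => A; rewrite inE sub1set => xA.
apply/forall_inP => B; rewrite inE sub1set => xB.
by apply/pred0Pn; exists x; apply/andP.
Qed.

(** A disjoint pair in the family already forces all the remaining members onto
    [k ^ 2] pairs of points; the summand 2 accounts for the pair itself. *)
Lemma dissociation_with_edge (n k : nat) (D : {set kneser_vertex n k}) A B :
  2 <= k -> dissociation_set (kneser n k) D ->
  A \in D -> B \in D -> kneser n k A B ->
  #|D| <= k ^ 2 * 'C(n - 2, k - 2) + 2.
Proof.
move=> k_ge2 /dissociationP dissD AD BD adjAB.
have adjBA : kneser n k B A by rewrite kneser_sym.
have card_pair : #|D :&: [set A; B]| <= 2.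
  apply: leq_trans (subset_leq_card (subsetIr _ _)) _.
  by rewrite cards2; case: (A != B).
rewrite -(cardsID [set A; B] D) addnC; apply: leq_add card_pair.
apply: (card_two_step_cover (F := A) (G := fun=> B)) => // [x xA | H | H x].
- by rewrite (disjointFr adjAB).
- rewrite !inE negb_or -andbA => /and3P[_ neqHB HD].
  by apply: contraNN neqHB => adjAH; rewrite (dissD A H B).
- rewrite !inE negb_or -andbA => /and3P[neqHA _ HD] _.
  by apply: contraNN neqHA => adjBH; rewrite (dissD B H A).
Qed.

Lemma intersecting_without_centre (n k : nat) (D : {set kneser_vertex n k}) A :
  2 <= k -> A \in D ->
  (forall H H', H \in D -> H' \in D -> ~~ kneser n k H H') ->
  (forall x, ~~ (D \subset vertices_above n k [set x])) ->
  #|D| <= k ^ 2 * 'C(n - 2, k - 2).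
Proof.
move=> k_ge2 AD interD no_centre.
have avoid x : exists H, (H \in D) && (x \notin val H).
  have /subsetPn[H HD] := no_centre x.
  by rewrite inE sub1set => xH; exists H; rewrite HD.
pose G x := xchoose (avoid x).
have GP x : (G x \in D) && (x \notin val (G x)) := xchooseP (avoid x).
apply: (card_two_step_cover (F := A) (G := G)) => // [x _ | H HD | H x HD _].
- by case/andP: (GP x).
- exact: interD.
- by case/andP: (GP x) => GD _; apply: interD.
Qed.

Lemma diss_le_star (n k : nat) :
  2 <= k <= n -> (k - 1) * (k ^ 2 + 2) < n ->
  diss (kneser n k) <= 'C(n - 1, k - 1).
Proof.
move=> kn n_large; have /andP[k_ge2 _] := kn.
have pairs_le := pair_bound_le_star kn n_large.
apply/bigmax_leqP => D dissD.
have [-> | [A AD]] := set_0Vmem D; first by rewrite cards0.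
have [/exists_inP[B BD /exists_inP[C CD adjBC]] | no_edge] :=
    boolP [exists B in D, exists C in D, kneser n k B C].
  exact: leq_trans (dissociation_with_edge k_ge2 dissD BD CD adjBC) pairs_le.
have [/existsP[x sDx] | no_centre] :=
    boolP [exists x, D \subset vertices_above n k [set x]].
  by rewrite -(card_star x (ltnW k_ge2)) subset_leq_card.
apply: leq_trans (leq_trans (leq_addr 2 _) pairs_le).
apply: (intersecting_without_centre k_ge2 AD) => [H H' HD H'D | x].
- apply: contraNN no_edge => adj; apply/exists_inP; exists H => //.
  by apply/exists_inP; exists H'.
- by apply: contraNN no_centre => sDx; apply/existsP; exists x.
Qed.

Theorem theorem2p2 :
  forall k : nat, 2 <= k ->
  exists n0 : nat, forall n : nat, n0 <= n -> 2 * k <= n ->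
    diss (kneser n k) = alpha (kneser n k)
    /\ alpha (kneser n k) = 'C(n - 1, k - 1).
Proof.
move=> k k_ge2; exists ((k - 1) * (k ^ 2 + 2)).+1 => n n_large le_2k_n.
have k_le_n : 2 <= k <= n by rewrite k_ge2 (leq_trans _ le_2k_n) ?leq_pmull.
have n_gt0 : 0 < n := leq_ltn_trans (leq0n _) n_large.
have ub := diss_le_star k_le_n n_large.
have lb := star_le_alpha (Ordinal n_gt0) (ltnW k_ge2).
have mid := alpha_le_diss (kneser n k).
split; apply/eqP; rewrite eqn_leq.
- by rewrite mid (leq_trans ub lb).
- by rewrite lb (leq_trans mid ub).
Qed.
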